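(* Let $n\ge4$, let $\epsilon_0,\dots,\epsilon_{n-1}$ be the standard basis of $\mathbb{R}^n$, and let $\Psi=\{\pm4\epsilon_i:0\le i\le n-1\}$. Let $\Delta=\{\alpha_0,\alpha_1,\dots,\alpha_{n-1},\alpha'_n\}$, where $\alpha_0=-4(\epsilon_0+\epsilon_1)$, $\alpha_i=4(\epsilon_{i-1}-\epsilon_i)$ for $0<i<n$, and $\alpha'_n=4(\epsilon_{n-2}+\epsilon_{n-1})$. (i) The $2n$-dimensional $\mathbb{C}$-vector space $V_\Psi$ has the structure of a $\mathfrak g$-module (via the operators $E_{\mathbf a},F_{\mathbf a},H_{\mathbf a}$, $\mathbf a\in\Delta$), where $\mathfrak g$ is the derived affine Kac--Moody algebra of type $D_n^{(1)}$. (ii) Let $\Psi'=\Psi$ and $\Delta'=\Delta\setminus\{\alpha_0\}$. Then $\Psi'$ is a minuscule system with respect to the simple system $\Delta'$, and $V_{\Psi'}$ is a module for the simple Lie algebra $\mathfrak d_n$ over $\mathbb{C}$ of type $D_n$. It is an irreducible module with highest weight vector $b_{4\epsilon_0}$ and lowest weight vector $b_{-4\epsilon_0}$, and affords the natural representation of $\mathfrak d_n$.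
   Context: Minuscule systems: $\mathbb{R}^n$ carries the usual scalar product. Let $\Psi,\Delta\subset\mathbb{R}^n$ with $0\notin\Delta$. $\Psi$ is a minuscule system with respect to the simple system $\Delta$ if for every $\mathbf v\in\Psi$ and $\mathbf a\in\Delta$: (i) $2\,\mathbf v\cdot\mathbf a = c\,\mathbf a\cdot\mathbf a$ for some $c=c(\mathbf v,\mathbf a)\in\{-1,0,1\}$; (ii) $\mathbf v+\mathbf a\in\Psi$ if and only if $c=-1$, and $\mathbf v-\mathbf a\in\Psi$ if and only if $c=1$. Operators: $V_\Psi$ is the vector space (here over $\mathbb{C}$) with basis $\{b_{\mathbf v}:\mathbf v\in\Psi\}$. For $\mathbf a\in\Delta$ the linear endomorphisms $E_{\mathbf a},F_{\mathbf a},H_{\mathbf a}$ of $V_\Psi$ are defined by: $E_{\mathbf a}(b_{\mathbf v})=b_{\mathbf v+\mathbf a}$ if $\mathbf v+\mathbf a\in\Psi$ and $0$ otherwise; $F_{\mathbf a}(b_{\mathbf v})=b_{\mathbf v-\mathbf a}$ if $\mathbf v-\mathbf a\in\Psi$ and $0$ otherwise; $H_{\mathbf a}(b_{\mathbf v})=c(\mathbf v,\mathbf a)\,b_{\mathbf v}$. Lie algebras: the generalized Cartan matrix of $\Delta$ is $A_{\mathbf a,\mathbf b}=2\frac{\mathbf a\cdot\mathbf b}{\mathbf a\cdot\mathbf a}$ ($\mathbf a,\mathbf b\in\Delta$). For a symmetrizable generalized Cartan matrix $A$, the derived Kac--Moody algebra $\mathfrak g'(A)$ is the Lie algebra over $\mathbb{C}$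 generated by $e_i,f_i,h_i$ subject to $[h_i,h_j]=0$, $[h_i,e_j]=A_{ij}e_j$, $[h_i,f_j]=-A_{ij}f_j$, $[e_i,f_j]=\delta_{ij}h_i$, and, for $i\ne j$, $(\mathrm{ad}\,e_i)^{1-A_{ij}}(e_j)=0=(\mathrm{ad}\,f_i)^{1-A_{ij}}(f_j)$; when $A$ is an (indecomposable) Cartan matrix of finite type this is the simple Lie algebra of that type. All module structures asserted are those in which the matrix of the indicated simple system is a generalized Cartan matrix of the stated type (types as in Kac's book) and the generators $e_{\mathbf a},f_{\mathbf a},h_{\mathbf a}$ act by $E_{\mathbf a},F_{\mathbf a},H_{\mathbf a}$. A weight vector (simultaneous eigenvector for all $h_i$) is a highest (respectively lowest) weight vector if it is annihilated by all $e_i$ (respectively all $f_i$). The natural representation of $\mathfrak d_n$ is $L(\omega_1)$, the irreducible module (of dimension $2n$) whose highest weight is the fundamental weight $\omega_1$ dual to $h_1$, where $\alpha_1,\dots,\alpha_{n-1},\alpha'_n$ label the simple roots $1,\dots,n$. *)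

(* Defs.v *)
From HB Require Import structures.
From mathcomp Require Import all_boot all_order all_algebra.
From mathcomp Require Import finmap complex.
From mathcomp Require Import boolp classical_sets reals.

Set Implicit Arguments.
Unset Strict Implicit.
Unset Printing Implicit Defensive.

Import Order.TTheory GRing.Theory Num.Theory.
Local Open Scope ring_scope.
Local Open Scope quotient_scope.

(* * Lie algebras and their modules *)

HB.mixin Record Lmodule_isLieAlgebra (K : fieldType) L of GRing.Lmodule K L := {
  lie : L -> L -> L;
  lieDZl : forall (a : K) (x y z : L),
    lie (a *: x + y) z = a *: lie x z + lie y z;
  lieDZr : forall (a : K) (x y z : L),
    lie z (a *: x + y) = a *: lie z x + lie z y;
  liexx : forall x : L, lie x x = 0;
  lie_jacobi : forall x y z : L,
    lie x (lie y z) + lie y (lie z x) + lie z (lie x y) = 0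
}.

#[short(type="lieAlgType")]
HB.structure Definition LieAlgebra (K : fieldType) :=
  {L of GRing.Lmodule K L & Lmodule_isLieAlgebra K L}.

Definition is_lie_module (K : fieldType) (L : lieAlgType K) (V : lmodType K)
    (act : L -> V -> V) : Prop :=
  [/\ forall (a : K) (x y : L) (v : V),
        act (a *: x + y) v = a *: act x v + act y v,
      forall (a : K) (x : L) (v w : V),
        act x (a *: v + w) = a *: act x v + act x w
    & forall (x y : L) (v : V),
        act (lie x y) v = act x (act y v) - act y (act x v)].

Definition is_irreducible (K : fieldType) (L : lieAlgType K) (V : vectType K)
    (act : L -> V -> V) : Prop :=
  (fullv : {vspace V}) <> 0%VS /\
  forall U : {vspace V},
    (forall (x : L) (u : V), u \in U -> act x u \in U) ->
    U = 0%VS \/ U = fullv.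

(* * Generalized Cartan matrices and their types *)

Definition is_gcm (I : Type) (A : I -> I -> int) : Prop :=
  [/\ forall i, A i i = 2,
      forall i j, i <> j -> A i j <= 0
    & forall i j, A i j = 0 -> A j i = 0].

Definition is_labelling (I J : Type) (A : I -> I -> int) (B : J -> J -> int)
    (f : J -> I) : Prop :=
  bijective f /\ forall i j, A (f i) (f j) = B i j.

Definition has_type (I J : Type) (A : I -> I -> int) (B : J -> J -> int) :
    Prop :=
  exists f : J -> I, is_labelling A B f.

Definition simply_laced (edge : rel nat) (i j : nat) : int :=
  if i == j then 2 else if edge i j || edge j i then -1 else 0.

(* The Dynkin diagram D_n, on the nodes 1, ..., n: the path 1 - ... - (n-1)
   with node n attached to node n-2. *)
Definition edgeD (n i j : nat) : bool :=
  ((0 < i)%N && (j == i.+1) && (j < n)%N) || ((i.+2 == n) && (j == n)).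

(* D_n^(1), on the nodes 0, ..., n: D_n with node 0 attached to node 2. *)
Definition edgeD1 (n i j : nat) : bool :=
  edgeD n i j || ((i == 0) && (j == 2)).

(* The ordinal i : 'I_n stands for the node i + 1. *)
Definition cartanD (n : nat) (i j : 'I_n) : int :=
  simply_laced (edgeD n) i.+1 j.+1.

Definition cartanD1 (n : nat) (i j : 'I_n.+1) : int :=
  simply_laced (edgeD1 n) i j.

(* * The derived Kac-Moody algebra g'(A), by generators and relations

   It is the type of formal Lie expressions in e_i, f_i, h_i modulo the least
   congruence containing the axioms of Lie algebras and the defining relations
   of g'(A). When A is of finite type, it is the simple Lie algebra of that
   type (Serre's theorem). *)

Inductive lie_expr (K I : Type) : Type :=
| LieE of I
| LieF of I
| LieH of I
| Lie0
| LieAdd of lie_expr K I & lie_expr K I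
| LieScale of K & lie_expr K I
| LieBr of lie_expr K I & lie_expr K I.

Arguments LieE {K I}. Arguments LieF {K I}. Arguments LieH {K I}.
Arguments Lie0 {K I}.

HB.instance Definition _ (K I : Type) := gen_eqMixin (lie_expr K I).
HB.instance Definition _ (K I : Type) := gen_choiceMixin (lie_expr K I).

(* For i != j the exponent 1 - A i j is nonnegative when A is a generalized
   Cartan matrix, so that the absolute value is only a cast to nat. *)
Inductive km_rel (K : fieldType) (I : Type) (A : I -> I -> int) :
    lie_expr K I -> lie_expr K I -> Prop :=
| km_refl x : km_rel A x x
| km_sym x y : km_rel A x y -> km_rel A y x
| km_trans x y z : km_rel A x y -> km_rel A y z -> km_rel A x z
| km_congD x x' y y' : km_rel A x x' -> km_rel A y y' ->
    km_rel A (LieAdd x y) (LieAdd x' y')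
| km_congZ a x x' : km_rel A x x' -> km_rel A (LieScale a x) (LieScale a x')
| km_congB x x' y y' : km_rel A x x' -> km_rel A y y' ->
    km_rel A (LieBr x y) (LieBr x' y')
| km_addA x y z :
    km_rel A (LieAdd x (LieAdd y z)) (LieAdd (LieAdd x y) z)
| km_addC x y : km_rel A (LieAdd x y) (LieAdd y x)
| km_add0 x : km_rel A (LieAdd Lie0 x) x
| km_addN x : km_rel A (LieAdd (LieScale (-1) x) x) Lie0
| km_scaleA a b x :
    km_rel A (LieScale a (LieScale b x)) (LieScale (a * b) x)
| km_scale1 x : km_rel A (LieScale 1 x) x
| km_scaleDr a x y :
    km_rel A (LieScale a (LieAdd x y)) (LieAdd (LieScale a x) (LieScale a y))
| km_scaleDl a b x :
    km_rel A (LieScale (a + b) x) (LieAdd (LieScale a x) (LieScale b x))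
| km_brDZl a x y z :
    km_rel A (LieBr (LieAdd (LieScale a x) y) z)
             (LieAdd (LieScale a (LieBr x z)) (LieBr y z))
| km_brDZr a x y z :
    km_rel A (LieBr z (LieAdd (LieScale a x) y))
             (LieAdd (LieScale a (LieBr z x)) (LieBr z y))
| km_brxx x : km_rel A (LieBr x x) Lie0
| km_jacobi x y z :
    km_rel A (LieAdd (LieAdd (LieBr x (LieBr y z)) (LieBr y (LieBr z x)))
                     (LieBr z (LieBr x y))) Lie0
| km_hh i j : km_rel A (LieBr (LieH i) (LieH j)) Lie0
| km_he i j :
    km_rel A (LieBr (LieH i) (LieE j)) (LieScale (A i j)%:~R (LieE j))
| km_hf i j :
    km_rel A (LieBr (LieH i) (LieF j)) (LieScale (- (A i j)%:~R) (LieF j))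
| km_ef i : km_rel A (LieBr (LieE i) (LieF i)) (LieH i)
| km_ef0 i j : i <> j -> km_rel A (LieBr (LieE i) (LieF j)) Lie0
| km_serre_e i j : i <> j ->
    km_rel A (iter `|1 - A i j|%N (LieBr (LieE i)) (LieE j)) Lie0
| km_serre_f i j : i <> j ->
    km_rel A (iter `|1 - A i j|%N (LieBr (LieF i)) (LieF j)) Lie0.

Definition km_relb (K : fieldType) (I : Type) (A : I -> I -> int) :
    rel (lie_expr K I) :=
  fun x y => `[< km_rel A x y >].

Lemma km_relb_refl (K : fieldType) (I : Type) (A : I -> I -> int) :
  reflexive (@km_relb K I A).
Proof. by move=> x; apply/asboolP; exact: km_refl. Qed.

Lemma km_relb_sym (K : fieldType) (I : Type) (A : I -> I -> int) :
  symmetric (@km_relb K I A).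
Proof. by move=> x y; apply/asboolP/asboolP; exact: km_sym. Qed.

Lemma km_relb_trans (K : fieldType) (I : Type) (A : I -> I -> int) :
  transitive (@km_relb K I A).
Proof.
by move=> y x z /asboolP xy /asboolP yz; apply/asboolP; exact: km_trans xy yz.
Qed.

Canonical km_equiv (K : fieldType) (I : Type) (A : I -> I -> int) :=
  EquivRel (@km_relb K I A) (km_relb_refl A) (km_relb_sym A)
    (km_relb_trans (A := A)).

Definition derived_km (K : fieldType) (I : Type) (A : I -> I -> int) : Type :=
  {eq_quot (@km_equiv K I A)}.

HB.instance Definition _ (K : fieldType) (I : Type) (A : I -> I -> int) :=
  Choice.on (derived_km K A).

Section DerivedKacMoody.
Context (K : fieldType) (I : Type) (A : I -> I -> int).
Local Notation g := (derived_km K A).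

Definition km_class (x : lie_expr K I) : g := \pi_{eq_quot (@km_equiv K I A)} x.

Definition km_repr (x : g) : lie_expr K I :=
  repr (x : {eq_quot (@km_equiv K I A)}).

Lemma km_classP x y : km_class x = km_class y <-> km_rel A x y.
Proof.
split=> [/eqP|xy]; first by rewrite /km_class eqmodE => /asboolP.
by apply/eqP; rewrite /km_class eqmodE; apply/asboolP.
Qed.

Lemma km_reprK : cancel km_repr km_class.
Proof. by move=> x; rewrite /km_class /km_repr reprK. Qed.

Lemma km_repr_class x : km_rel A (km_repr (km_class x)) x.
Proof. by apply/km_classP; rewrite km_reprK. Qed.

Lemma km_ind (P : g -> Prop) : (forall x, P (km_class x)) -> forall x, P x.
Proof. by move=> PP x; rewrite -[x]km_reprK. Qed.

Definition km_zero : g := km_class Lie0.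
Definition km_add (x y : g) : g := km_class (LieAdd (km_repr x) (km_repr y)).
Definition km_scale (a : K) (x : g) : g := km_class (LieScale a (km_repr x)).
Definition km_opp (x : g) : g := km_scale (-1) x.
Definition km_lie (x y : g) : g := km_class (LieBr (km_repr x) (km_repr y)).

Lemma km_addE x y :
  km_add (km_class x) (km_class y) = km_class (LieAdd x y).
Proof. by apply/km_classP; apply: km_congD; exact: km_repr_class. Qed.

Lemma km_scaleE a x : km_scale a (km_class x) = km_class (LieScale a x).
Proof. by apply/km_classP; apply: km_congZ; exact: km_repr_class. Qed.

Lemma km_lieE x y :
  km_lie (km_class x) (km_class y) = km_class (LieBr x y).
Proof. by apply/km_classP; apply: km_congB; exact: km_repr_class. Qed.

Let kmE := (km_addE, km_scaleE, km_lieE).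

Fact km_add_assoc : associative km_add.
Proof.
elim/km_ind=> x; elim/km_ind=> y; elim/km_ind=> z.
by rewrite !kmE; apply/km_classP; exact: km_addA.
Qed.

Fact km_add_comm : commutative km_add.
Proof.
elim/km_ind=> x; elim/km_ind=> y.
by rewrite !kmE; apply/km_classP; exact: km_addC.
Qed.

Fact km_add_zero : left_id km_zero km_add.
Proof. by elim/km_ind=> x; rewrite !kmE; apply/km_classP; exact: km_add0. Qed.

Fact km_add_opp : left_inverse km_zero km_opp km_add.
Proof.
by elim/km_ind=> x; rewrite /km_opp !kmE; apply/km_classP; exact: km_addN.
Qed.

HB.instance Definition _ :=
  GRing.isZmodule.Build g km_add_assoc km_add_comm km_add_zero km_add_opp.

Fact km_scale_assoc a b x : km_scale a (km_scale b x) = km_scale (a * b) x.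
Proof.
by elim/km_ind: x => x; rewrite !kmE; apply/km_classP; exact: km_scaleA.
Qed.

Fact km_scale_one : left_id 1 km_scale.
Proof. by elim/km_ind=> x; rewrite !kmE; apply/km_classP; exact: km_scale1. Qed.

Fact km_scale_addr : right_distributive km_scale +%R.
Proof.
move=> a; elim/km_ind=> x; elim/km_ind=> y.
by rewrite /GRing.add /= !kmE; apply/km_classP; exact: km_scaleDr.
Qed.

Fact km_scale_addl x : {morph km_scale^~ x : a b / a + b}.
Proof.
move=> a b; elim/km_ind: x => x.
by rewrite [in RHS]/GRing.add /= !kmE; apply/km_classP; exact: km_scaleDl.
Qed.

HB.instance Definition _ :=
  GRing.Zmodule_isLmodule.Build K g km_scale_assoc km_scale_one
    km_scale_addr km_scale_addl.

Lemma km_class0 : km_class Lie0 = 0. Proof. by []. Qed.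

Lemma km_classD x y : km_class (LieAdd x y) = km_class x + km_class y.
Proof. by rewrite -km_addE. Qed.

Lemma km_classZ a x : km_class (LieScale a x) = a *: km_class x.
Proof. by rewrite -km_scaleE. Qed.

Fact km_lie_DZl (a : K) (x y z : g) :
  km_lie (a *: x + y) z = a *: km_lie x z + km_lie y z.
Proof.
elim/km_ind: x => x; elim/km_ind: y => y; elim/km_ind: z => z.
by rewrite -km_classZ -km_classD !kmE -km_classZ -km_classD;
  apply/km_classP; exact: km_brDZl.
Qed.

Fact km_lie_DZr (a : K) (x y z : g) :
  km_lie z (a *: x + y) = a *: km_lie z x + km_lie z y.
Proof.
elim/km_ind: x => x; elim/km_ind: y => y; elim/km_ind: z => z.
by rewrite -km_classZ -km_classD !kmE -km_classZ -km_classD;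
  apply/km_classP; exact: km_brDZr.
Qed.

Fact km_lie_xx (x : g) : km_lie x x = 0.
Proof.
by elim/km_ind: x => x; rewrite kmE -km_class0; apply/km_classP; exact: km_brxx.
Qed.

Fact km_lie_jacobi (x y z : g) :
  km_lie x (km_lie y z) + km_lie y (km_lie z x) + km_lie z (km_lie x y) = 0.
Proof.
elim/km_ind: x => x; elim/km_ind: y => y; elim/km_ind: z => z.
by rewrite !kmE -!km_classD; apply/km_classP; exact: km_jacobi.
Qed.

HB.instance Definition _ :=
  Lmodule_isLieAlgebra.Build K g km_lie_DZl km_lie_DZr km_lie_xx
    km_lie_jacobi.

Definition km_e (i : I) : g := km_class (LieE i).
Definition km_f (i : I) : g := km_class (LieF i).
Definition km_h (i : I) : g := km_class (LieH i).

End DerivedKacMoody.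

(* * Weights *)

Definition is_weight_vector (K : fieldType) (I : Type) (A : I -> I -> int)
    (V : lmodType K) (act : derived_km K A -> V -> V) (lambda : I -> K)
    (v : V) : Prop :=
  v <> 0 /\ forall i, act (km_h K A i) v = lambda i *: v.

Definition is_highest_weight_vector (K : fieldType) (I : Type)
    (A : I -> I -> int) (V : lmodType K) (act : derived_km K A -> V -> V)
    (v : V) : Prop :=
  (exists lambda, is_weight_vector act lambda v) /\
  forall i, act (km_e K A i) v = 0.

Definition is_lowest_weight_vector (K : fieldType) (I : Type)
    (A : I -> I -> int) (V : lmodType K) (act : derived_km K A -> V -> V)
    (v : V) : Prop :=
  (exists lambda, is_weight_vector act lambda v) /\
  forall i, act (km_f K A i) v = 0.

(* The module V is L(lambda), the irreducible module of highest weight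
   lambda. *)
Definition is_irreducible_of_highest_weight (K : fieldType) (I : Type)
    (A : I -> I -> int) (V : vectType K) (act : derived_km K A -> V -> V)
    (lambda : I -> K) : Prop :=
  is_irreducible act /\
  exists v : V, is_highest_weight_vector act v /\ is_weight_vector act lambda v.

(* The fundamental weight dual to h_i. *)
Definition fundamental_weight (K : fieldType) (I : eqType) (i : I) : I -> K :=
  fun j => (j == i)%:R.

(* * Minuscule systems *)

Definition dot (R : realType) (n : nat) (u v : 'rV[R]_n) : R :=
  \sum_(i < n) u 0 i * v 0 i.

Definition is_minuscule (R : realType) (n : nat) (Psi Delta : set 'rV[R]_n) :
    Prop :=
  ~ Delta 0 /\
  forall v a, Psi v -> Delta a ->
    exists c : R,
      [/\ c = -1 \/ c = 0 \/ c = 1,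
          2 * dot v a = c * dot a a,
          Psi (v + a) <-> c = -1
        & Psi (v - a) <-> c = 1].

Definition coef (R : realType) (n : nat) (v a : 'rV[R]_n) : R :=
  2 * dot v a / dot a a.

Definition is_cartan_matrix_of (R : realType) (n : nat)
    (Delta : {fset 'rV[R]_n}) (A : Delta -> Delta -> int) : Prop :=
  forall a b : Delta,
    (A a b)%:~R = 2 * dot (val a) (val b) / dot (val a) (val a).

(* * The space V_Psi, over the complex numbers R[i], and its operators *)

Definition Vsp (R : realType) (n : nat) (Psi : {fset 'rV[R]_n}) :
    vectType R[i] :=
  {ffun Psi -> R[i]^o}.

(* The basis vector b_v; by convention it is 0 when v is not in Psi. *)
Definition bas (R : realType) (n : nat) (Psi : {fset 'rV[R]_n})
    (v : 'rV[R]_n) : Vsp Psi :=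
  [ffun w : Psi => (val w == v)%:R].

Definition lin_ext (R : realType) (n : nat) (Psi : {fset 'rV[R]_n})
    (g : Psi -> Vsp Psi) (x : Vsp Psi) : Vsp Psi :=
  \sum_(v : Psi) x v *: g v.

Lemma lin_ext_bas (R : realType) (n : nat) (Psi : {fset 'rV[R]_n})
    (g : Psi -> Vsp Psi) (v : Psi) : lin_ext g (bas Psi (val v)) = g v.
Proof.
rewrite /lin_ext (bigD1 v) //= ffunE eqxx scale1r big1 ?addr0 // => w wv.
by rewrite ffunE (inj_eq val_inj) (negbTE wv) scale0r.
Qed.

Definition opE (R : realType) (n : nat) (Psi : {fset 'rV[R]_n})
    (a : 'rV[R]_n) : Vsp Psi -> Vsp Psi :=
  lin_ext (fun v => if val v + a \in Psi then bas Psi (val v + a) else 0).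

Definition opF (R : realType) (n : nat) (Psi : {fset 'rV[R]_n})
    (a : 'rV[R]_n) : Vsp Psi -> Vsp Psi :=
  lin_ext (fun v => if val v - a \in Psi then bas Psi (val v - a) else 0).

Definition opH (R : realType) (n : nat) (Psi : {fset 'rV[R]_n})
    (a : 'rV[R]_n) : Vsp Psi -> Vsp Psi :=
  lin_ext (fun v => ((coef (val v) a)%:C)%C *: bas Psi (val v)).

Definition acts_by_operators (R : realType) (n : nat)
    (Psi Delta : {fset 'rV[R]_n}) (A : Delta -> Delta -> int)
    (act : derived_km R[i] A -> Vsp Psi -> Vsp Psi) : Prop :=
  forall (a : Delta) (x : Vsp Psi),
    [/\ act (km_e R[i] A a) x = opE (val a) x,
        act (km_f R[i] A a) x = opF (val a) x
      & act (km_h R[i] A a) x = opH (val a) x].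

(* * The data of types D_n^(1) and D_n *)

Definition eps (R : realType) (n k : nat) : 'rV[R]_n :=
  \row_(j < n) (nat_of_ord j == k)%:R.

(* The k-th vector of alpha_0, alpha_1, ..., alpha_(n-1), alpha'_n. *)
Definition simple_root (R : realType) (n k : nat) : 'rV[R]_n :=
  if k == 0%N then - 4 *: (eps R n 0 + eps R n 1)
  else if k == n then 4 *: (eps R n n.-2 + eps R n n.-1)
  else 4 *: (eps R n k.-1 - eps R n k).

Definition PsiD (R : realType) (n : nat) : {fset 'rV[R]_n} :=
  ([fset 4 *: eps R n (nat_of_ord i) | i : 'I_n]
   `|` [fset - 4 *: eps R n (nat_of_ord i) | i : 'I_n])%fset.

Definition DeltaD1 (R : realType) (n : nat) : {fset 'rV[R]_n} :=
  [fset simple_root R n (nat_of_ord i) | i : 'I_n.+1]%fset.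

Definition DeltaD (R : realType) (n : nat) : {fset 'rV[R]_n} :=
  (DeltaD1 R n `\ simple_root R n 0)%fset.

(* The module V_Psi is L(omega_1), where omega_1 is dual to h_(alpha_1). *)
Definition is_natural_representation (R : realType) (n : nat)
    (A : DeltaD R n -> DeltaD R n -> int)
    (act : derived_km R[i] A -> Vsp (PsiD R n) -> Vsp (PsiD R n)) : Prop :=
  \dim {: Vsp (PsiD R n)} = (2 * n)%N /\
  exists2 a1 : DeltaD R n, val a1 = simple_root R n 1
    & is_irreducible_of_highest_weight act (fundamental_weight R[i] a1).

(* Main.v *)
Require Import Defs.
From HB Require Import structures.
From mathcomp Require Import all_boot all_order all_algebra.
From mathcomp Require Import finmap complex.
From mathcomp Require Import boolp classical_sets reals.
From mathcomp Require Import zify ring lra.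

Set Implicit Arguments.
Unset Strict Implicit.
Unset Printing Implicit Defensive.

Import Order.TTheory GRing.Theory Num.Theory.
Local Open Scope ring_scope.

(** The statement is an instance of a general fact about minuscule systems.
    Each of the two simple systems is minuscule for [Psi], and for any minuscule
    system whose Cartan matrix [A] is a generalized Cartan matrix, the operators
    [E_a], [F_a], [H_a] satisfy the defining relations of g'(A)
    ([minuscule_module]). Since [c] is additive in its first argument, [E_b]
    shifts the eigenvalue of [H_a] by [A a b]. Everything else follows from
    [|c| <= 1] and the fact that [v + a] is in [Psi] exactly when
    [c (v, a) = -1]:
    - if [b . a >= 0], a path [v], [v + b], [v + b + a] in [Psi] forces
      [v + a] to be in [Psi], so [E_a] and [E_b] commute; since
      [F_b = E_(- b)], this covers [[E_a, F_b] = 0] as well as the Serre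
      relations with [A a b = 0];
    - [E_a E_a = 0], and [E_a E_b E_a = 0] when [A a b = -1]. As
      [(ad E_a)^2 E_b = - 2 E_a E_b E_a] and [(ad E_a)^3 E_b = 0] for an
      operator [E_a] of square zero, the other Serre relations follow.

    The elements of both simple systems are sums of two weights along distinct
    axes. Such a vector [a] has [a . a = 32], and the minuscule conditions come
    from comparing the norms of [v], [a] and [v + a] ([rootD_raise]). The
    Cartan integers are computed in [dot_simple_root]; they also show that the
    listed simple roots are pairwise distinct ([cartan_injective]).

    Irreducibility over d_n ([minuscule_irreducible]) needs two properties of
    the finite simple system. Its coefficients [c] separate the weights, because
    it spans the whole space ([DeltaD_separates]), and the weights are connected
    by simple roots ([PsiD_connected]): [alpha_1, ..., alpha_(n-1)] link the
    vectors [4 epsilon_k] to each other and the vectors [- 4 epsilon_k] to each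
    other, and [alpha'_n] links [- 4 epsilon_(n-1)] to [4 epsilon_(n-2)].
    Finally, [c (4 epsilon_0, alpha_k)] is [1] for [k = 1] and [0] for
    [1 < k <= n], so that [4 epsilon_0] is the highest weight, namely the first
    fundamental weight, and [- 4 epsilon_0] is the lowest one. *)

(** * Commutators of endomorphisms and modules over g'(A) *)

Section Commutators.
Variables (K : fieldType) (V : lmodType K).
Implicit Types x y z : V -> V.

(** The commutator [x y - y x] for composition. It is defined on all maps, and
    linearity is a hypothesis where it matters. *)
Definition commutator x y : V -> V := fun u => x (y u) - y (x u).

Lemma commutator_linear x y : linear x -> linear y -> linear (commutator x y).
Proof.
move=> Lx Ly a u v; rewrite /commutator Ly Lx Lx Ly.
by rewrite scalerBr opprD addrACA.
Qed.

Lemma linear_fun0 x : linear x -> x 0 = 0.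
Proof.
by move=> Lx; move: (Lx (-1) 0 0); rewrite scaler0 addr0 scaleN1r addNr.
Qed.

Lemma linear_funB x u v : linear x -> x (u - v) = x u - x v.
Proof. by move=> Lx; rewrite -scaleN1r addrC Lx scaleN1r addrC. Qed.

Lemma commutator_jacobi x y z u : linear x -> linear y -> linear z ->
  commutator x (commutator y z) u + commutator y (commutator z x) u
  + commutator z (commutator x y) u = 0.
Proof.
have E (M : zmodType) (a b c d : M) : a - b - (c - d) = (a + d) - (b + c).
  by rewrite opprB addrACA -opprD.
move=> Lx Ly Lz; rewrite /commutator (linear_funB _ _ Lx) (linear_funB _ _ Ly).
rewrite (linear_funB _ _ Lz) !E.
rewrite [X in _ + (X - _) + _]addrC [X in _ + (_ - X) + _]addrC.
rewrite [X in _ + _ + (_ - X)]addrC.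
by rewrite !subrKA subrr.
Qed.

(** If [x \o x = 0], then [(ad x)^2 y = - 2 x y x], which vanishes if
    [x y x = 0]. *)
Lemma iter_commutator2 x y : linear x ->
  (forall u, x (x u) = 0) -> (forall u, x (y (x u)) = 0) -> linear y ->
  forall u, iter 2 (commutator x) y u = 0.
Proof.
move=> Lx xx xyx Ly u.
rewrite /= /commutator (linear_funB _ _ Lx) !(xx, xyx).
by rewrite (linear_fun0 Ly) !subrr.
Qed.

(** If [x \o x = 0], then [(ad x)^k y = 0] for [k >= 3]. *)
Lemma iter_commutator3 x y k : linear x -> linear y ->
  (forall u, x (x u) = 0) -> (2 < k)%N ->
  forall u, iter k (commutator x) y u = 0.
Proof.
move=> Lx Ly xx; elim: k => // k IHk.
rewrite ltnS leq_eqVlt => /orP[/eqP<-|/IHk H] u.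
  rewrite iterSr iter_commutator2 // => [{}u|].
    rewrite /commutator (linear_funB _ _ Lx) !xx.
    by rewrite (linear_fun0 Ly) (linear_fun0 Lx) subrr.
  exact: commutator_linear.
by rewrite iterS /commutator !H (linear_fun0 Lx) subrr.
Qed.

End Commutators.

Section KacMoodyModule.
Variables (K : fieldType) (I : Type) (A : I -> I -> int) (V : lmodType K).
Variables e f h : I -> V -> V.

(** The value of a formal Lie expression when the generators are sent to the
    maps [e i], [f i], [h i] from [V] to itself. *)
Fixpoint lie_eval (x : lie_expr K I) : V -> V :=
  match x with
  | LieE i => e i
  | LieF i => f i
  | LieH i => h i
  | Lie0 => fun=> 0
  | LieAdd x y => fun u => lie_eval x u + lie_eval y u
  | LieScale a x => fun u => a *: lie_eval x u
  | LieBr x y => commutator (lie_eval x) (lie_eval y)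
  end.

Lemma lie_eval_iter x y k :
  lie_eval (iter k (LieBr x) y) = iter k (commutator (lie_eval x)) (lie_eval y).
Proof. by elim: k => //= k ->. Qed.

Hypotheses (Le : forall i, linear (e i)) (Lf : forall i, linear (f i))
  (Lh : forall i, linear (h i)).

Lemma lie_eval_linear x : linear (lie_eval x).
Proof.
elim: x => //= [a u v|x Lx y Ly a u v|b x Lx a u v|x Lx y Ly].
- by rewrite scaler0 addr0.
- by rewrite Lx Ly scalerDr addrACA.
- by rewrite Lx scalerDr !scalerA mulrC.
- exact: commutator_linear.
Qed.

Hypothesis hh : forall i j u, commutator (h i) (h j) u = 0.
Hypothesis he : forall i j u, commutator (h i) (e j) u = (A i j)%:~R *: e j u.
Hypothesis hf : forall i j u,
  commutator (h i) (f j) u = - (A i j)%:~R *: f j u.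
Hypothesis ef : forall i u, commutator (e i) (f i) u = h i u.
Hypothesis ef0 : forall i j u, i <> j -> commutator (e i) (f j) u = 0.
Hypothesis ee : forall i j u, i <> j ->
  iter `|1 - A i j|%N (commutator (e i)) (e j) u = 0.
Hypothesis ff : forall i j u, i <> j ->
  iter `|1 - A i j|%N (commutator (f i)) (f j) u = 0.

Lemma lie_eval_rel x y : km_rel A x y -> lie_eval x =1 lie_eval y.
Proof.
have L := lie_eval_linear.
elim=> {x y} //=.
- by move=> x y _ xy u; rewrite xy.
- by move=> x y z _ xy _ yz u; rewrite xy.
- by move=> x x' y y' _ xx _ yy u; rewrite xx yy.
- by move=> a x x' _ xx u; rewrite xx.
- by move=> x x' y y' _ xx _ yy u; rewrite /commutator !(xx, yy).
- by move=> x y z u; rewrite addrA.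
- by move=> x y u; rewrite addrC.
- by move=> x u; rewrite add0r.
- by move=> x u; rewrite scaleN1r addNr.
- by move=> a b x u; rewrite scalerA.
- by move=> x u; rewrite scale1r.
- by move=> a x y u; rewrite scalerDr.
- by move=> a b x u; rewrite scalerDl.
- by move=> a x y z u; rewrite /commutator L scalerBr opprD addrACA.
- by move=> a x y z u; rewrite /commutator L scalerBr opprD addrACA.
- by move=> x u; rewrite /commutator subrr.
- by move=> x y z u; exact: commutator_jacobi.
- by move=> i j ij u; exact: ef0.
- by move=> i j ij u; rewrite lie_eval_iter; exact: ee.
- by move=> i j ij u; rewrite lie_eval_iter; exact: ff.
Qed.

(** Linear maps that satisfy the defining relations of g'(A) make [V] a
    module over it. *)
Lemma derived_km_module : exists act : derived_km K A -> V -> V,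
  is_lie_module act /\
  forall i v, [/\ act (km_e K A i) v = e i v, act (km_f K A i) v = f i v
                & act (km_h K A i) v = h i v].
Proof.
pose act (x : derived_km K A) := lie_eval (km_repr x) : V -> V.
have actE x v : act (km_class A x) v = lie_eval x v.
  by rewrite /act (lie_eval_rel (km_repr_class A x)).
exists act; split; last by move=> i v; rewrite !actE.
split.
- move=> a x y v; elim/km_ind: x => x; elim/km_ind: y => y.
  by rewrite -km_classZ -km_classD !actE.
- by move=> a x v w; rewrite /act lie_eval_linear.
- move=> x y v; elim/km_ind: x => x; elim/km_ind: y => y.
  have -> : lie (km_class A x) (km_class A y) = km_class A (LieBr x y).
    exact: km_lieE.
  by rewrite !actE.
Qed.

End KacMoodyModule.

(** * The scalar product and the coefficients c(v, a) *)

Section Dot.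
Variables (R : realType) (n : nat).
Implicit Types u v w a b : 'rV[R]_n.

Lemma dotC u v : dot u v = dot v u.
Proof. by apply: eq_bigr => i _; rewrite mulrC. Qed.

Lemma dotDl u v w : dot (u + v) w = dot u w + dot v w.
Proof. by rewrite -big_split; apply: eq_bigr => i _; rewrite mxE mulrDl. Qed.

Lemma dotZl x u v : dot (x *: u) v = x * dot u v.
Proof. by rewrite mulr_sumr; apply: eq_bigr => i _; rewrite mxE mulrA. Qed.

Lemma dotNl u v : dot (- u) v = - dot u v.
Proof. by rewrite -scaleN1r dotZl mulN1r. Qed.

Lemma dotDr u v w : dot w (u + v) = dot w u + dot w v.
Proof. by rewrite !(dotC w) dotDl. Qed.

Lemma dotZr x u v : dot u (x *: v) = x * dot u v.
Proof. by rewrite !(dotC u) dotZl. Qed.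

Lemma dotNr u v : dot u (- v) = - dot u v.
Proof. by rewrite !(dotC u) dotNl. Qed.

Lemma dot_eq0 a : (dot a a == 0) = (a == 0).
Proof.
apply/idP/eqP => [|->]; last by rewrite -(scale0r 0) dotZl mul0r.
rewrite psumr_eq0 => [/allP a0|i _]; last by rewrite -expr2 sqr_ge0.
apply/rowP => i; have := a0 i (mem_index_enum i).
by rewrite mulf_eq0 orbb mxE => /eqP.
Qed.

Lemma coefDl u v a : coef (u + v) a = coef u a + coef v a.
Proof. by rewrite /coef dotDl mulrDr mulrDl. Qed.

Lemma coefNl v a : coef (- v) a = - coef v a.
Proof. by rewrite /coef dotNl mulrN mulNr. Qed.

Lemma coefNr v a : coef v (- a) = - coef v a.
Proof. by rewrite /coef !(dotNl, dotNr) opprK mulrN mulNr. Qed.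

Lemma coefaa a : a != 0 -> coef a a = 2.
Proof. by move=> a0; rewrite /coef mulfK // dot_eq0. Qed.

End Dot.

(** * Vectors acting in a minuscule way on a set of weights *)

(** The conditions (i) and (ii) of a minuscule system for a single vector [a],
    with the coefficient c(v, a) written out. They are stable under
    [a |-> - a], which exchanges raising and lowering operators. *)
Definition minuscule_vector (R : realType) (n : nat) (Psi : {fset 'rV[R]_n})
    (a : 'rV[R]_n) : Prop :=
  a != 0 /\
  forall v, v \in Psi ->
    [/\ coef v a = -1 \/ coef v a = 0 \/ coef v a = 1,
        v + a \in Psi <-> coef v a = -1
      & v - a \in Psi <-> coef v a = 1].

Lemma minuscule_vectorN (R : realType) (n : nat) (Psi : {fset 'rV[R]_n})
    (a : 'rV[R]_n) :
  minuscule_vector Psi a -> minuscule_vector Psi (- a).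
Proof.
case=> a0 H; split; first by rewrite oppr_eq0.
move=> v /H[c Hp Hm]; rewrite coefNr opprK.
split.
- case: c => [->|[->|->]]; last by left.
  + by right; right; rewrite opprK.
  + by right; left; rewrite oppr0.
- by split=> [/Hm->//|c1]; apply/Hm; rewrite -[LHS]opprK c1 opprK.
- by split=> [/Hp->|c1]; rewrite ?opprK //; apply/Hp; rewrite -[LHS]opprK c1.
Qed.

Lemma minuscule_raise (R : realType) (n : nat) (Psi : {fset 'rV[R]_n})
    (a v : 'rV[R]_n) :
  minuscule_vector Psi a -> v \in Psi -> v + a \in Psi -> coef v a = -1.
Proof. by case=> _ H /H[_ Hp _] /Hp. Qed.

Lemma is_minusculeP (R : realType) (n : nat) (Psi Delta : {fset 'rV[R]_n}) :
  is_minuscule [set` Psi]%classic [set` Delta]%classic <->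
  forall a, a \in Delta -> minuscule_vector Psi a.
Proof.
split=> [[D0 H] a aD|H].
  have a0 : a != 0 by apply: contraPneq aD => ->; exact: D0.
  split=> // v vP; have [c [cE dE Hp Hm]] := H v a vP aD.
  suff -> : coef v a = c by split.
  by rewrite /coef dE mulfK // dot_eq0.
split=> [D0|v a /= vP aD]; first by case: (H 0 D0); rewrite eqxx.
have [a0 /(_ v vP)[cE Hp Hm]] := H a aD.
exists (coef v a); split=> //.
by rewrite /coef mulfVK // dot_eq0.
Qed.

(** * The operators of a minuscule system *)

Section Operators.
Variables (R : realType) (n : nat) (Psi : {fset 'rV[R]_n}).
Implicit Types (a b v w : 'rV[R]_n) (x y : Vsp Psi).
Local Notation V := (Vsp Psi).

(** The convention that [bas Psi v] is [0] outside [Psi] lets [E_a] be written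
    [b_v |-> b_(v + a)] without a case distinction ([opE_bas] below). *)
Lemma bas_notin v : v \notin Psi -> bas Psi v = 0.
Proof.
move=> vP; apply/ffunP => w; rewrite !ffunE.
by case: eqP => // wv; rewrite -wv (valP w) in vP.
Qed.

Lemma bas_neq0 v : v \in Psi -> bas Psi v <> 0.
Proof.
move=> vP /ffunP/(_ [` vP]%fset); rewrite !ffunE eqxx => /eqP.
by rewrite oner_eq0.
Qed.

Lemma lin_ext_linear (g : Psi -> V) : linear (lin_ext g).
Proof.
move=> c x y; rewrite /lin_ext scaler_sumr -big_split; apply: eq_bigr => v _.
by rewrite !ffunE scalerDl scalerA.
Qed.

Lemma Vsp_basis x : x = lin_ext (fun v : Psi => bas Psi (val v)) x.
Proof.
apply/ffunP => w; rewrite /lin_ext sum_ffunE (bigD1 w) //= !ffunE eqxx.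
rewrite [_ *: _]mulr1 big1 ?addr0 // => v vw.
by rewrite !ffunE (inj_eq val_inj) eq_sym (negbTE vw) scaler0.
Qed.

Lemma Vsp_linear_ext (f g : V -> V) : linear f -> linear g ->
  (forall v, v \in Psi -> f (bas Psi v) = g (bas Psi v)) -> f =1 g.
Proof.
move=> Lf Lg fg x; rewrite [x]Vsp_basis /lin_ext.
elim/big_ind: _ => [|y z fy fz|v _].
- by rewrite (linear_fun0 Lf) (linear_fun0 Lg).
- by rewrite -[y]scale1r Lf Lg !scale1r fy fz.
- rewrite -[_ *: _]addr0 Lf Lg (fg _ (valP v)).
  by rewrite (linear_fun0 Lf) (linear_fun0 Lg).
Qed.

Lemma Vsp_linear_ext0 (f : V -> V) : linear f ->
  (forall v, v \in Psi -> f (bas Psi v) = 0) -> forall x, f x = 0.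
Proof.
move=> Lf; apply: (Vsp_linear_ext Lf) => c y z.
by rewrite scaler0 addr0.
Qed.

Lemma linear_funZ (f : V -> V) c x : linear f -> f (c *: x) = c *: f x.
Proof. by move=> Lf; rewrite -[_ *: x]addr0 Lf (linear_fun0 Lf) addr0. Qed.

Lemma opE_linear a : linear (@opE R n Psi a).
Proof. exact: lin_ext_linear. Qed.

Lemma opH_linear a : linear (@opH R n Psi a).
Proof. exact: lin_ext_linear. Qed.

Lemma opFE a : @opF R n Psi a = opE (- a).
Proof. by []. Qed.

Lemma opE_bas a v : v \in Psi -> opE a (bas Psi v) = bas Psi (v + a).
Proof.
move=> vP; rewrite /opE (lin_ext_bas _ [` vP]%fset) /=.
by case: ifPn => // /bas_notin->.
Qed.

Lemma opH_bas a v : opH a (bas Psi v) = (coef v a)%:C%C *: bas Psi v.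
Proof.
case: (boolP (v \in Psi)) => [vP|/bas_notin->].
  by rewrite /opH (lin_ext_bas _ [` vP]%fset).
by rewrite scaler0; exact: linear_fun0 (opH_linear a).
Qed.

Lemma opH_coord a x (w : Psi) : opH a x w = (coef (val w) a)%:C%C * x w.
Proof.
rewrite /opH /lin_ext sum_ffunE (bigD1 w) // big1 => [|v vw].
  by rewrite !ffunE eqxx [LHS]addr0 [_%:C%C *: _]mulr1 [LHS]mulrC.
by rewrite !ffunE (inj_eq val_inj) eq_sym (negbTE vw) /GRing.scale /= !mulr0.
Qed.

Lemma opE_opE_bas a b v : v \in Psi ->
  opE a (opE b (bas Psi v)) = if v + b \in Psi then bas Psi (v + b + a) else 0.
Proof.
move=> vP; rewrite opE_bas //; case: ifPn => [/opE_bas->//|/bas_notin->].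
exact: linear_fun0 (opE_linear a).
Qed.

Lemma commutator_opH a b x : commutator (opH a) (opH b) x = 0.
Proof.
have [La Lb] := (opH_linear a, opH_linear b).
apply: (@Vsp_linear_ext0 (commutator (opH a) (opH b))) => [|v vP].
  exact: commutator_linear La Lb.
rewrite /commutator !opH_bas (linear_funZ _ _ La) (linear_funZ _ _ Lb).
by rewrite !opH_bas !scalerA mulrC subrr.
Qed.

Lemma commutator_opHE a b x :
  commutator (opH a) (opE b) x = (coef b a)%:C%C *: opE b x.
Proof.
have [La Lb] := (opH_linear a, opE_linear b).
apply: (@Vsp_linear_ext (commutator (opH a) (opE b))
  (fun y => (coef b a)%:C%C *: opE b y)) x.
- exact: commutator_linear La Lb.
- by move=> c y z /=; rewrite Lb scalerDr !scalerA mulrC.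
move=> v vP; rewrite /commutator opH_bas (linear_funZ _ _ Lb).
rewrite opE_bas // opH_bas.
by rewrite coefDl rmorphD scalerDl addrAC subrr add0r.
Qed.

Lemma commutator_opEF a x : minuscule_vector Psi a ->
  commutator (opE a) (opF a) x = opH a x.
Proof.
move=> [a0 Ha]; have [La Lb] := (opE_linear a, opE_linear (- a)).
rewrite opFE.
apply: (Vsp_linear_ext (f := commutator (opE a) (opE (- a)))) => [||v vP].
- exact: commutator_linear La Lb.
- exact: opH_linear.
rewrite /commutator !opE_opE_bas // opH_bas subrK addrK.
have [c Hp Hm] := Ha v vP.
case: ifPn => [/Hm c1|/negP nm]; case: ifPn => [/Hp c2|/negP np].
- by exfalso; move: c2; rewrite c1; lra.
- by rewrite c1 scale1r subr0.
- by rewrite c2 rmorphN scaleN1r sub0r.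
- by case: c => [/Hp//|[->|/Hm//]]; rewrite scale0r subr0.
Qed.

(** If [b . a >= 0], then a path from [v] to [v + b + a] that runs inside [Psi]
    and adds [b] first may as well add [a] first. *)
Lemma minuscule_swap a b v : minuscule_vector Psi a -> 0 <= coef b a ->
  v \in Psi -> v + b \in Psi -> v + b + a \in Psi -> v + a \in Psi.
Proof.
move=> Ha ba vP vbP /(minuscule_raise Ha vbP); rewrite coefDl => E.
have [c Hp _] := Ha.2 v vP; apply/Hp.
by case: c => [//|[c|c]]; move: E ba; rewrite c; lra.
Qed.

Lemma commutator_opE a b x :
  minuscule_vector Psi a -> minuscule_vector Psi b ->
  0 <= coef b a -> 0 <= coef a b -> commutator (opE a) (opE b) x = 0.
Proof.
move=> Ha Hb ba ab; have [La Lb] := (opE_linear a, opE_linear b).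
apply: (@Vsp_linear_ext0 (commutator (opE a) (opE b))) => [|v vP].
  exact: commutator_linear La Lb.
rewrite /commutator !opE_opE_bas // (addrAC v b).
have [vP'|/bas_notin->] := boolP (v + a + b \in Psi); last first.
  by rewrite !if_same subrr.
suff -> : (v + b \in Psi) = (v + a \in Psi) by rewrite subrr.
apply/idP/idP => H; last exact: minuscule_swap vP'.
by apply: (minuscule_swap Ha ba vP H); rewrite addrAC.
Qed.

Lemma opE_opE a x : minuscule_vector Psi a -> opE a (opE a x) = 0.
Proof.
move=> Ha; have La := opE_linear a.
apply: (@Vsp_linear_ext0 (opE a \o opE a)) => [c y z /=|v vP /=].
  by rewrite !La.
rewrite opE_opE_bas //; case: ifPn => // vaP; apply/bas_notin/negP.
move/(minuscule_raise Ha vaP).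
by rewrite coefDl coefaa ?Ha.1 // (minuscule_raise Ha vP vaP); lra.
Qed.

Lemma opE_opE_opE a b x : minuscule_vector Psi a -> coef b a = -1 ->
  opE a (opE b (opE a x)) = 0.
Proof.
move=> Ha ba; have [La Lb] := (opE_linear a, opE_linear b).
apply: (@Vsp_linear_ext0 (opE a \o opE b \o opE a)) => [c y z /=|v vP /=].
  by rewrite La Lb La.
rewrite opE_bas //.
case: (boolP (v + a \in Psi)) => [vaP|/bas_notin->]; last first.
  by rewrite (linear_fun0 Lb) (linear_fun0 La).
rewrite opE_opE_bas //; case: ifPn => // vabP; apply/bas_notin/negP.
move/(minuscule_raise Ha vabP).
by rewrite !coefDl coefaa ?Ha.1 // ba (minuscule_raise Ha vP vaP); lra.
Qed.

(** The Serre relations. Taking [- a] and [- b] for [a] and [b] gives those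
    between the lowering operators. *)
Lemma serre_opE a b (m : int) x :
  minuscule_vector Psi a -> minuscule_vector Psi b ->
  m <= 0 -> m%:~R = coef b a ->
  iter `|1 - m|%N (commutator (opE a)) (opE b) x = 0.
Proof.
move=> Ha Hb m0 mE; have [La Lb] := (opE_linear a, opE_linear b).
have [m3|] := ltnP 2 `|1 - m|%N.
  by apply: (iter_commutator3 La Lb _ m3) => y; exact: opE_opE.
move=> m2; have {m2} [m1|m2] : m = 0 \/ m = -1 by lia.
  subst m; rewrite /= commutator_opE -?mE //.
  have : coef b a = 0 by rewrite -mE.
  rewrite /coef => /eqP; rewrite mulf_eq0 invr_eq0 dot_eq0 (negbTE Ha.1) orbF.
  by rewrite dotC => /eqP->; rewrite mul0r.
subst m; apply: (iter_commutator2 La _ _ Lb) => y; first exact: opE_opE.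
by apply: opE_opE_opE => //; rewrite -mE.
Qed.

End Operators.

(** A minuscule system whose Cartan matrix is a generalized Cartan matrix [A]
    yields a module over g'(A). *)
Lemma minuscule_module (R : realType) (n : nat) (Psi Delta : {fset 'rV[R]_n})
    (A : Delta -> Delta -> int) :
  is_minuscule [set` Psi]%classic [set` Delta]%classic ->
  is_cartan_matrix_of A -> is_gcm A ->
  exists act : derived_km R[i] A -> Vsp Psi -> Vsp Psi,
    is_lie_module act /\ acts_by_operators act.
Proof.
move=> /is_minusculeP HD AE [A2 Ale0 _].
have H (a : Delta) : minuscule_vector Psi (val a) by apply: HD; exact: valP.
have coefA (a b : Delta) : coef (val b) (val a) = (A a b)%:~R.
  by rewrite AE /coef dotC.
have castA (a b : Delta) : (coef (val b) (val a))%:C%C = (A a b)%:~R.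
  by rewrite coefA rmorph_int.
apply: (@derived_km_module _ _ A (Vsp Psi) (fun a => opE (val a))
  (fun a => opF (val a)) (fun a => opH (val a))).
- by move=> a; exact: opE_linear.
- by move=> a; exact: opE_linear.
- by move=> a; exact: opH_linear.
- by move=> a b u; exact: commutator_opH.
- by move=> a b u; rewrite commutator_opHE castA.
- by move=> a b u; rewrite opFE commutator_opHE coefNl -castA -rmorphN.
- by move=> a u; exact: commutator_opEF.
- move=> a b u ab; rewrite opFE; apply: commutator_opE => //.
  + exact: minuscule_vectorN.
  + by rewrite coefNl coefA oppr_ge0 lerz0 Ale0.
  + by rewrite coefNr coefA oppr_ge0 lerz0 Ale0 // => /esym.
- by move=> a b u ab; apply: serre_opE => //; exact: Ale0.
- move=> a b u ab; apply: serre_opE; try exact: minuscule_vectorN.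
    exact: Ale0.
  by rewrite coefNl coefNr opprK coefA.
Qed.

(** * Irreducibility *)

(** If the coefficients c(v, a) separate the weights, and every weight can be
    reached from every other one by adding and subtracting elements of [Delta]
    inside [Psi], then the module is irreducible. In an invariant subspace, a
    vector with two weights [v] and [w] in its support can be replaced by its
    image under [h_a - c(w, a)], whose support is smaller; so the subspace
    contains some [b_v], hence all of them. *)
Lemma minuscule_irreducible (R : realType) (n : nat)
    (Psi Delta : {fset 'rV[R]_n}) (A : Delta -> Delta -> int)
    (act : derived_km R[i] A -> Vsp Psi -> Vsp Psi) :
  (exists v, v \in Psi) -> acts_by_operators act ->
  (forall v w, v \in Psi -> w \in Psi ->
     (forall a, a \in Delta -> coef v a = coef w a) -> v = w) ->
  (forall S : 'rV[R]_n -> Prop, (exists2 v, v \in Psi & S v) ->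
     (forall v a, v \in Psi -> a \in Delta -> v + a \in Psi ->
        S v <-> S (v + a)) ->
     forall v, v \in Psi -> S v) ->
  is_irreducible act.
Proof.
move=> [v0 v0P] acts sep conn; split.
  move=> full0.
  have : bas Psi v0 \in (fullv : {vspace Vsp Psi}) by exact: memvf.
  by rewrite full0 memv0 => /eqP; exact: bas_neq0.
move=> U invU.
have UE a x : a \in Delta -> x \in U ->
    [/\ opE a x \in U, opF a x \in U & opH a x \in U].
  by move=> aD xU; have [<- <- <-] := acts [` aD]%fset x; rewrite !invU.
have supp k (x : Vsp Psi) : (#|[pred v | x v != 0%R]| <= k)%N -> x \in U ->
    x != 0 -> exists2 v, v \in Psi & bas Psi v \in U.
  elim: k x => [|k IHk] x.
    rewrite leqn0 => /pred0P x0 _ /negP[]; apply/eqP/ffunP => v.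
    by rewrite ffunE; apply/eqP/negbFE; exact: x0.
  move=> sx xU x0.
  have [v xv] : exists v, x v != 0.
    apply/existsP; apply: contraNT x0 => /existsPn x0; apply/eqP/ffunP => v.
    by rewrite ffunE; apply/eqP/negPn; exact: x0.
  have [[w xw wv]|only] := pselect (exists2 w, x w != 0 & w != v); last first.
    exists (val v); first exact: valP.
    suff -> : bas Psi (val v) = (x v)^-1 *: x by rewrite memvZ.
    apply/ffunP => w; rewrite !ffunE (inj_eq val_inj).
    have [->|wv] := eqVneq w v; first by rewrite /GRing.scale /= mulVf.
    suff -> : x w = 0 by rewrite scaler0.
    by apply/eqP; apply/negPn/negP => xw; apply: only; exists w.
  have [a aD vwa] : exists2 a, a \in Delta & coef (val v) a <> coef (val w) a.
    apply: contrapT => none; case/eqP: wv; apply/val_inj/sep => [||a aD].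
    - exact: valP.
    - exact: valP.
    - by apply: contrapT => vwa; apply: none; exists a => //; exact/nesym.
  pose y : Vsp Psi := opH a x - (coef (val w) a)%:C%C *: x.
  have yE u : y u = (coef (val u) a - coef (val w) a)%:C%C * x u.
    by rewrite /y !ffunE opH_coord rmorphB mulrBl.
  apply: (IHk y).
  - rewrite -ltnS; apply: leq_trans sx; apply: proper_card; apply/properP.
    split.
      apply/fintype.subsetP => u; rewrite !inE yE mulf_eq0 negb_or.
      by move=> /andP[].
    by exists w; rewrite !inE // yE subrr mul0r eqxx.
  - by have [_ _ hU] := UE a x aD xU; rewrite memvB // memvZ.
  - apply: contraNneq xv => y0; move: (yE v); rewrite y0 ffunE => /esym/eqP.
    rewrite mulf_eq0 => /orP[|//]; rewrite -(rmorph0 (real_complex R)).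
    by rewrite (inj_eq (@complexI R)) subr_eq0 => /eqP.
have [->|U0] := eqVneq U 0%VS; [by left | right].
have [v vP vU] : exists2 v, v \in Psi & bas Psi v \in U.
  by apply: (supp _ _ (leqnn _) (memv_pick U)); rewrite vpick0.
have allU : forall w, w \in Psi -> bas Psi w \in U.
  apply: conn; first by exists v.
  move=> w a wP aD waP; split=> wU.
    by have [+ _ _] := UE a _ aD wU; rewrite opE_bas.
  by have [_ + _] := UE a _ aD wU; rewrite opFE opE_bas // addrK.
apply/vspaceP => x; rewrite memvf [x]Vsp_basis /lin_ext.
by apply: memv_suml => w _; apply/memvZ/allU; exact: valP.
Qed.

(** * Labelled Cartan matrices *)

Lemma simply_laced_gcm (I : Type) (edge : rel nat) (lab : I -> nat) :
  injective lab -> is_gcm (fun i j => simply_laced edge (lab i) (lab j)).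
Proof.
move=> inj; rewrite /simply_laced; split=> [i|i j ij|i j].
  by rewrite eqxx.
  by case: eqP => [/inj//|_]; case: ifP.
by rewrite eq_sym orbC.
Qed.

(** Vectors whose Cartan integers form a generalized Cartan matrix are
    pairwise distinct, because off-diagonal entries are not [2]. *)
Lemma cartan_injective (R : realType) (n : nat) (J : Type)
    (B : J -> J -> int) (r : J -> 'rV[R]_n) :
  is_gcm B -> (forall i j, (B i j)%:~R = coef (r j) (r i)) -> injective r.
Proof.
move=> [B2 Ble0 _] BE i j rij; apply: contrapT => /Ble0.
have -> : B i j = 2; last by [].
by rewrite -(B2 i); apply: (@intr_inj R); rewrite !BE rij.
Qed.

(** A parametrization of [Delta] by [J] transports a matrix of Cartan integers
    from [J] to [Delta]. *)
Lemma cartan_labelling (R : realType) (n : nat) (Delta : {fset 'rV[R]_n})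
    (J : Type) (B : J -> J -> int) (r : J -> 'rV[R]_n) :
  is_gcm B -> (forall i j, (B i j)%:~R = coef (r j) (r i)) ->
  (forall a, a \in Delta <-> exists j, a = r j) ->
  exists A : Delta -> Delta -> int,
    [/\ is_cartan_matrix_of A, is_gcm A
      & exists2 lab : J -> Delta,
          is_labelling A B lab & forall j, val (lab j) = r j].
Proof.
move=> gB BE rD; have inj := cartan_injective gB BE.
have rin j : r j \in Delta by apply/rD; exists j.
have ex (a : Delta) : exists j, val a = r j by apply/rD; exact: valP.
pose idx a := projT1 (cid (ex a)).
have idxE a : r (idx a) = val a by rewrite /idx; case: cid.
pose lab j : Delta := [` rin j]%fset.
have labK : cancel lab idx by move=> j; apply: inj; rewrite idxE.
have idxK : cancel idx lab by move=> a; apply: val_inj; rewrite /= idxE.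
exists (fun a b => B (idx a) (idx b)); split.
- by move=> a b; rewrite BE !idxE /coef dotC.
- case: gB => B2 Ble0 B0; split=> // [a b ab|a b]; last exact: B0.
  by apply: Ble0 => E; apply: ab; rewrite -[a]idxK E.
- by exists lab => //; split; [exists idx | move=> i j; rewrite !labK].
Qed.

(** * The vectors of type D_n *)

Section TypeD.
Variables (R : realType) (n : nat).
Local Notation Psi := (PsiD R n).

(** The vector [4 epsilon_k] for [s = false], and [- 4 epsilon_k] for
    [s = true]. *)
Definition weightD (s : bool) (k : nat) : 'rV[R]_n :=
  (4 * (-1) ^+ s) *: eps R n k.

Lemma weightDF k : weightD false k = 4 *: eps R n k.
Proof. by rewrite /weightD mulr1. Qed.

Lemma weightDT k : weightD true k = - 4 *: eps R n k.
Proof. by rewrite /weightD mulrN1. Qed.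

Lemma weightDN s k : - weightD s k = weightD (~~ s) k.
Proof.
by rewrite /weightD -scaleNr; case: s; rewrite /= expr0 expr1 ?mulrN ?opprK.
Qed.

Lemma dot_epsr (v : 'rV[R]_n) (k : 'I_n) : dot v (eps R n k) = v 0 k.
Proof.
rewrite /dot (bigD1 k) //= big1 => [|j jk]; rewrite !mxE ?eqxx ?mulr1 ?addr0 //.
by rewrite -[(j == k :> nat)]/(j == k) (negbTE jk) mulr0.
Qed.

Lemma dot_eps i j : (i < n)%N -> dot (eps R n i) (eps R n j) = (i == j)%:R.
Proof.
by move=> ltin; rewrite dotC -[i in LHS]/(val (Ordinal ltin)) dot_epsr mxE.
Qed.

Lemma dot_weightD s t i j : (i < n)%N ->
  dot (weightD s i) (weightD t j) = 16 * (-1) ^+ (s (+) t) * (i == j)%:R.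
Proof.
by move=> ltin; rewrite dotZl dotZr dot_eps // signr_addb; ring.
Qed.

Lemma PsiDP v : v \in Psi <-> exists s k, (k < n)%N /\ v = weightD s k.
Proof.
split=> [|[s [k [kn ->]]]].
  rewrite !inE => /orP[/imfsetP[k _ ->]|/imfsetP[k _ ->]].
    by exists false, k; rewrite weightDF ltn_ord.
  by exists true, k; rewrite weightDT ltn_ord.
rewrite !inE; apply/orP; case: s; [right|left];
  apply/imfsetP; exists (Ordinal kn) => //=; by rewrite ?weightDF ?weightDT.
Qed.

Lemma weightD_in s k : (k < n)%N -> weightD s k \in Psi.
Proof. by move=> kn; apply/PsiDP; exists s, k. Qed.

Lemma dot_PsiD v : v \in Psi -> dot v v = 16.
Proof.
by move=> /PsiDP[s [k [kn ->]]]; rewrite dot_weightD // addbb eqxx !mulr1.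
Qed.

Lemma weightD_inj s t i j : (i < n)%N -> (j < n)%N ->
  weightD s i = weightD t j -> s = t /\ i = j.
Proof.
move=> ltin ltjn E; have := dot_PsiD (weightD_in s ltin).
rewrite {2}E dot_weightD // => {E ltin ltjn}.
case: eqP => [->|_]; last by by rewrite mulr0 => H; exfalso; lra.
by case: s; case: t => //= H; move: H; rewrite ?expr1 => H; exfalso; lra.
Qed.

Lemma card_PsiD : #|{: Psi}| = (2 * n)%N.
Proof.
have -> : (2 * n)%N = #|{: bool * 'I_n}|.
  by rewrite card_prod card_bool card_ord.
pose f (x : bool * 'I_n) : Psi := [` weightD_in x.1 (ltn_ord x.2)]%fset.
have finj : injective f.
  move=> [s i] [t j] /(congr1 val) /= /weightD_inj.
  by move=> /(_ (ltn_ord i) (ltn_ord j)) [-> /val_inj->].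
rewrite -(card_codom finj); apply: eq_card => v; rewrite inE; apply/esym/codomP.
have /PsiDP[s [k [kn vE]]] := valP v.
by exists (s, Ordinal kn); apply: val_inj.
Qed.

Lemma dim_VspD : \dim {: Vsp Psi} = (2 * n)%N.
Proof.
rewrite dimvf -card_PsiD.
have -> : dim (Vsp Psi) = (#|{: Psi}| * dim (R[i]^o : vectType R[i]))%N by [].
by rewrite /dim /= muln1.
Qed.

(** The sum of two weights along distinct axes: these are four times the roots
    of type D_n. *)
Definition is_rootD (a : 'rV[R]_n) : Prop := exists p q s t,
  [/\ (p < n)%N, (q < n)%N, p <> q & a = weightD s p + weightD t q].

Lemma is_rootDN a : is_rootD a -> is_rootD (- a).
Proof.
move=> [p [q [s [t [pn qn pq ->]]]]]; exists p, q, (~~ s), (~~ t); split=> //.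
by rewrite opprD !weightDN.
Qed.

Lemma dot_rootD a : is_rootD a -> dot a a = 32.
Proof.
move=> [p [q [s [t [pn qn pq ->]]]]].
rewrite !(dotDl, dotDr) !dot_weightD // !addbb !eqxx (eq_sym q).
by move/eqP/negbTE: pq => ->; rewrite !mulr0 !mulr1; lra.
Qed.

(** If [v + a] is a weight, then comparing norms, [16 = 16 + 2 v.a + 32], gives
    c(v, a) = -1. *)
Lemma rootD_raise v a : is_rootD a -> v \in Psi ->
  (coef v a = -1 \/ coef v a = 0 \/ coef v a = 1) /\
  (v + a \in Psi <-> coef v a = -1).
Proof.
move=> ra vP; have aa := dot_rootD ra; have vv := dot_PsiD vP.
have fwd : v + a \in Psi -> coef v a = -1.
  move=> /dot_PsiD; rewrite !(dotDl, dotDr) aa vv (dotC a) /coef aa; lra.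
move: ra vP => [p [q [s [t [pn qn pq aE]]]]] /PsiDP[u [k [kn vE]]].
have cE : coef v a = (-1) ^+ (u (+) s) * (k == p)%:R +
                     (-1) ^+ (u (+) t) * (k == q)%:R.
  by rewrite /coef aa vE aE dotDr !dot_weightD //; field.
suff H : [\/ v + a \in Psi, coef v a = 0 | coef v a = 1].
  have [/fwd c|c|c] := H.
  - by split; [left|split=> // _; case: H => //; lra].
  - by split; [right; left|split=> //; lra].
  - by split; [right; right|split=> //; lra].
rewrite cE; have [kp|kp] := eqVneq k p; have [kq|kq] := eqVneq k q.
- by case: pq; rewrite -kp -kq.
- have [us|us] := eqVneq u s.
    by constructor 3; rewrite us addbb mulr0 mulr1 addr0.
  constructor 1; rewrite vE aE kp.
  have -> : u = ~~ s by case: (u) us; case: (s).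
  by rewrite -weightDN addKr weightD_in.
- have [ut|ut] := eqVneq u t.
    by constructor 3; rewrite ut addbb mulr0 mulr1 add0r.
  constructor 1; rewrite vE aE kq.
  have -> : u = ~~ t by case: (u) ut; case: (t).
  by rewrite -weightDN addrC addrK weightD_in.
- by constructor 2; rewrite !mulr0 addr0.
Qed.

Lemma rootD_minuscule a : is_rootD a -> minuscule_vector Psi a.
Proof.
move=> ra; split.
  by rewrite -dot_eq0 dot_rootD // pnatr_eq0.
move=> v vP; have [c Hp] := rootD_raise ra vP; split=> //.
have [_] := rootD_raise (is_rootDN ra) vP; rewrite coefNr => ->.
by split=> [/oppr_inj|->].
Qed.

End TypeD.
(** * The simple systems of types D_n^(1) and D_n *)

Section SimpleSystems.
Variables (R : realType) (n : nat).
Hypothesis n_ge4 : (4 <= n)%N.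
Local Notation Psi := (PsiD R n).
Local Notation alpha := (simple_root R n).

Lemma simple_root0 : alpha 0 = weightD R n true 0 + weightD R n true 1.
Proof. by rewrite /simple_root eqxx scalerDr !weightDT. Qed.

Lemma simple_root_last :
  alpha n = weightD R n false n.-2 + weightD R n false n.-1.
Proof.
rewrite /simple_root eqxx; case: eqP => [|_]; first by lia.
by rewrite scalerDr !weightDF.
Qed.

Lemma simple_rootS k : (k.+1 < n)%N ->
  alpha k.+1 = weightD R n false k + weightD R n true k.+1.
Proof.
move=> kn; rewrite /simple_root /= ltn_eqF // scalerDr weightDF weightDT.
by rewrite scalerN scaleNr.
Qed.

Lemma simple_root_rootD k : (k <= n)%N -> is_rootD (alpha k).
Proof.
rewrite leq_eqVlt => /orP[/eqP->|].
  exists n.-2, n.-1, false, false; rewrite -simple_root_last.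
  by split=> //; lia.
case: k => [|k] kn.
  by exists 0%N, 1%N, true, true; rewrite -simple_root0; split=> //; lia.
by exists k, k.+1, false, true; rewrite -simple_rootS //; split=> //; lia.
Qed.

(** Turns an equation between scalar products of sums of weights and Cartan
    integers into one between indicators of equalities of indices, and checks
    it case by case. *)
Local Ltac indicators := rewrite !(dotDl, dotDr) !dot_weightD; try lia;
  rewrite /simply_laced /edgeD1 /edgeD /=;
  repeat (first [case: eqP => ? | case: ltnP => ?];
          try (by exfalso; lia)) => /=;
  rewrite ?expr0 ?expr1; lra.

Lemma dot_simple_root i j : (i <= n)%N -> (j <= n)%N ->
  dot (alpha i) (alpha j) = 16 * (simply_laced (edgeD1 n) i j)%:~R.
Proof.
rewrite leq_eqVlt => /orP[/eqP->|]; last case: i => [|i] li.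
all: rewrite leq_eqVlt => /orP[/eqP->|]; last case: j => [|j] lj.
all: rewrite ?simple_root0 ?simple_root_last ?simple_rootS //.
all: indicators.
Qed.

Lemma coef_simple_root (i j : 'I_n.+1) :
  (cartanD1 i j)%:~R = coef (alpha j) (alpha i).
Proof.
have [lei lej] : (i <= n)%N /\ (j <= n)%N by split; rewrite -ltnS.
rewrite /coef (dot_rootD (simple_root_rootD lei)) dotC dot_simple_root //.
by rewrite /cartanD1; lra.
Qed.

Lemma cartanD1_gcm : is_gcm (@cartanD1 n).
Proof. exact/simply_laced_gcm/ord_inj. Qed.

Lemma cartanD_gcm : is_gcm (@cartanD n).
Proof.
by apply: (@simply_laced_gcm _ _ (fun i : 'I_n => i.+1)) => i j [] /ord_inj.
Qed.

(** The edge that D_n^(1) has in addition to D_n ends at node 0. *)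
Lemma cartanD_cartanD1 (i j : 'I_n) :
  cartanD i j = cartanD1 (lift ord0 i) (lift ord0 j).
Proof.
by rewrite /cartanD /cartanD1 /simply_laced /edgeD1 !lift0 !orbF.
Qed.

Lemma simple_root_inj i j : (i <= n)%N -> (j <= n)%N ->
  alpha i = alpha j -> i = j.
Proof.
move=> lei lej; rewrite -ltnS in lei; rewrite -ltnS in lej.
by move=> /(cartan_injective cartanD1_gcm coef_simple_root
  (x1 := Ordinal lei) (x2 := Ordinal lej)) /(congr1 val).
Qed.

Lemma DeltaD1P a : a \in DeltaD1 R n <-> exists i : 'I_n.+1, a = alpha i.
Proof.
split=> [/imfsetP[i _ ->]|[i ->]]; first by exists i.
by apply/imfsetP; exists i.
Qed.

Lemma DeltaDP a : a \in DeltaD R n <-> exists i : 'I_n, a = alpha i.+1.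
Proof.
rewrite /DeltaD in_fsetD1; split=> [/andP[a0 /DeltaD1P[i aE]]|[i ->]].
  case: (unliftP ord0 i) aE => [j ->|-> aE]; first by exists j.
  by rewrite aE eqxx in a0.
apply/andP; split; last first.
  by apply/DeltaD1P; exists (lift ord0 i).
by apply/eqP => /simple_root_inj; rewrite ltn_ord => /(_ isT isT).
Qed.

Lemma simple_root_in k : (k < n)%N -> alpha k.+1 \in DeltaD R n.
Proof. by move=> kn; apply/DeltaDP; exists (Ordinal kn). Qed.

Lemma DeltaD1_minuscule :
  is_minuscule [set` Psi]%classic [set` DeltaD1 R n]%classic.
Proof.
apply/is_minusculeP => a /DeltaD1P[i ->].
by apply/rootD_minuscule/simple_root_rootD; rewrite -ltnS.
Qed.

Lemma DeltaD_minuscule :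
  is_minuscule [set` Psi]%classic [set` DeltaD R n]%classic.
Proof.
apply/is_minusculeP => a /DeltaDP[i ->].
exact/rootD_minuscule/simple_root_rootD.
Qed.

(** A vector orthogonal to [alpha_1, ..., alpha_(n-1)] has equal coordinates,
    and these vanish if it is also orthogonal to [alpha'_n]. *)
Lemma DeltaD_separates v w :
  (forall a, a \in DeltaD R n -> coef v a = coef w a) -> v = w.
Proof.
move=> vw; apply/eqP; rewrite -subr_eq0; apply/eqP; set y := v - w.
have y0 k : (k < n)%N -> dot y (alpha k.+1) = 0.
  move=> kn; have := vw _ (simple_root_in kn).
  rewrite /coef (dot_rootD (simple_root_rootD kn)) /y dotDl dotNl; lra.
pose c k := dot y (eps R n k).
have cS k : (k.+1 < n)%N -> c k.+1 = c k.
  move=> kn; have := y0 k (ltnW kn).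
  rewrite simple_rootS // weightDF weightDT dotDr !dotZr -!/(c _); lra.
have cE k : (k < n)%N -> c k = c 0%N.
  by elim: k => // k IHk kn; rewrite cS // IHk // ltnW.
have c0 : c 0%N = 0.
  have nn : n.-1.+1 = n by lia.
  have := y0 n.-1; rewrite nn => /(_ (leqnn _)).
  rewrite simple_root_last !weightDF dotDr !dotZr -!/(c _) !cE; try lia; lra.
by apply/rowP => k; rewrite -dot_epsr -/(c k) cE // c0 mxE.
Qed.

Lemma PsiD_connected (S : 'rV[R]_n -> Prop) :
  (exists2 v, v \in Psi & S v) ->
  (forall v a, v \in Psi -> a \in DeltaD R n -> v + a \in Psi ->
     S v <-> S (v + a)) ->
  forall v, v \in Psi -> S v.
Proof.
move=> [v vP Sv] step; pose T s k := S (weightD R n s k).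
have TS s k : (k.+1 < n)%N -> T s k.+1 <-> T s k.
  move=> kn; have kn' := ltnW kn; rewrite /T; case: s.
    have E : weightD R n true k + alpha k.+1 = weightD R n true k.+1.
      by rewrite simple_rootS // -(weightDN _ _ false) addKr.
    by apply: iff_sym; rewrite -E; apply: step;
      rewrite ?E ?weightD_in ?simple_root_in //.
  have E : weightD R n false k.+1 + alpha k.+1 = weightD R n false k.
    by rewrite simple_rootS // -(weightDN _ _ false) addrC addrNK.
  by rewrite -[in X in _ <-> X]E; apply: step;
    rewrite ?E ?weightD_in ?simple_root_in //.
have T0 s k : (k < n)%N -> T s k <-> T s 0%N.
  by elim: k => // k IHk kn; rewrite TS // IHk // ltnW.
have TN : T true 0%N <-> T false 0%N.
  rewrite -(T0 true n.-1) -?(T0 false n.-2); try lia.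
  have E : weightD R n true n.-1 + alpha n = weightD R n false n.-2.
    by rewrite simple_root_last addrCA -(weightDN _ _ false) addNr addr0.
  rewrite /T -E; apply: step; rewrite ?E ?weightD_in //; try lia.
  have nn : n.-1.+1 = n by lia.
  by have := @simple_root_in n.-1; rewrite nn; apply.
have Tall s k : (k < n)%N -> T s k <-> T false 0%N.
  by move=> kn; rewrite T0 //; case: s.
move=> w /PsiDP[t [j [jn ->]]]; rewrite -/(T t j) Tall //.
by move: Sv; have /PsiDP[s [k [kn ->]]] := vP; rewrite -/(T s k) Tall.
Qed.

Lemma coef_weightD0 k : (k < n)%N ->
  coef (weightD R n false 0) (alpha k.+1) = (k == 0%N)%:R.
Proof.
move=> kn; rewrite /coef (dot_rootD (simple_root_rootD kn)).
have n0 : (0 < n)%N by lia.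
have [nk|kn'] : n = k.+1 \/ (k.+1 < n)%N by lia.
  rewrite -nk simple_root_last dotDr !dot_weightD //.
  by do !case: eqP; try lia; rewrite ?mulr0 ?addr0 ?mulr0 ?mul0r.
rewrite simple_rootS // dotDr !dot_weightD // (eq_sym 0%N).
by rewrite mulr0 addr0 /= expr0 mulr1; case: eqP => _; lra.
Qed.

End SimpleSystems.

Theorem proposition6p2 (R : realType) (n : nat) (n_ge4 : (4 <= n)%N) :
  (* (i) *)
  (\dim {: Vsp (PsiD R n)} = (2 * n)%N /\
   exists A : DeltaD1 R n -> DeltaD1 R n -> int,
     [/\ is_cartan_matrix_of A, is_gcm A, has_type A (@cartanD1 n)
       & exists act : derived_km R[i] A -> Vsp (PsiD R n) -> Vsp (PsiD R n),
           is_lie_module act /\ acts_by_operators act])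
  /\
  (* (ii) *)
  (is_minuscule [set` PsiD R n] [set` DeltaD R n] /\
   exists A : DeltaD R n -> DeltaD R n -> int,
     [/\ is_cartan_matrix_of A, is_gcm A,
         exists2 lab : 'I_n -> DeltaD R n,
           is_labelling A (@cartanD n) lab
           & forall i : 'I_n, val (lab i) = simple_root R n i.+1
       & exists act : derived_km R[i] A -> Vsp (PsiD R n) -> Vsp (PsiD R n),
           [/\ is_lie_module act /\ acts_by_operators act,
               is_irreducible act,
               is_highest_weight_vector act
                 (bas (PsiD R n) (4 *: eps R n 0)),
               is_lowest_weight_vector act
                 (bas (PsiD R n) (- 4 *: eps R n 0))
             & is_natural_representation act]]).
Proof.
have dimV := dim_VspD R n.
split.
  split=> //.
  have [A [AE gA [lab labA _]]] := cartan_labelling (@cartanD1_gcm n)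
    (coef_simple_root R n_ge4) (DeltaD1P (R := R) (n := n)).
  exists A; split=> //; first by exists lab.
  exact: minuscule_module (DeltaD1_minuscule R n_ge4) AE gA.
have minD := DeltaD_minuscule R n_ge4; split=> //.
have coefD (i j : 'I_n) :
    (cartanD i j)%:~R = coef (simple_root R n j.+1) (simple_root R n i.+1).
  by rewrite cartanD_cartanD1 coef_simple_root.
have [A [AE gA [lab labA labE]]] := cartan_labelling (@cartanD_gcm n)
  coefD (@DeltaDP R n n_ge4).
exists A; split=> //; first by exists lab.
have [act [Lact acts]] := minuscule_module minD AE gA.
exists act.
have n0 : (0 < n)%N by lia.
have vP s := weightD_in R s n0.
rewrite -weightDF -weightDT.
have bas0 s := bas_neq0 (vP s).
have irr : is_irreducible act.
  apply: minuscule_irreducible => //.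
  - by exists (weightD R n false 0).
  - by move=> v w _ _; exact: DeltaD_separates.
  - exact: PsiD_connected.
have DE (a : DeltaD R n) : exists2 k, (k < n)%N & val a = simple_root R n k.+1.
  by have [i aE] := (DeltaDP n_ge4 (val a)).1 (valP a); exists i.
have wt s : is_weight_vector act
    (fun a => (coef (weightD R n s 0) (val a))%:C%C) (bas _ (weightD R n s 0)).
  split=> [|a]; first exact: bas0.
  by have [_ _ ->] := acts a (bas _ (weightD R n s 0)); rewrite opH_bas.
have hw : is_highest_weight_vector act (bas _ (weightD R n false 0)).
  split; first by eexists; exact: wt.
  move=> a; have [-> _ _] := acts a (bas _ (weightD R n false 0)).
  rewrite opE_bas //; apply/bas_notin/negP.
  have [k kn ->] := DE a.
  have ra := simple_root_rootD R n_ge4 kn.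
  move/(minuscule_raise (rootD_minuscule ra) (vP _)).
  by rewrite coef_weightD0 //; case: eqP => _ /=; lra.
split=> //.
  split; first by eexists; exact: wt.
  move=> a; have [_ -> _] := acts a (bas _ (weightD R n true 0)).
  rewrite opFE opE_bas //; apply/bas_notin/negP.
  have [k kn ->] := DE a.
  have rN := is_rootDN (simple_root_rootD R n_ge4 kn).
  move/(minuscule_raise (rootD_minuscule rN) (vP _)).
  rewrite coefNr -(weightDN _ _ false) coefNl opprK.
  by rewrite coef_weightD0 //; case: eqP => _ /=; lra.
split=> //.
have a1P := simple_root_in R n_ge4 n0.
exists [` a1P]%fset => //; split=> //.
exists (bas _ (weightD R n false 0)); split=> //.
have [nz wtE] := wt false; split=> // a; rewrite wtE; congr (_ *: _).
have [k kn aE] := DE a; rewrite aE coef_weightD0 // rmorph_nat.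
rewrite /fundamental_weight -(inj_eq val_inj) aE /=; congr ((nat_of_bool _)%:R).
by apply/idP/idP => [/eqP->//|/eqP/(simple_root_inj n_ge4 kn n0)[->]].
Qed.
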